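(* Let $f,g:\mathbb{R}^n\to\mathbb{R}$ be two $C^2$-smooth functions such that $\lim_{p\to\infty}f(p)=+\infty$, $\lim_{p\to\infty}g(p)=+\infty$ and $\langle\nabla f,\nabla g\rangle+\|\nabla f\|\cdot\|\nabla g\|>0$ almost everywhere. If the sets $R(f\oplus g)$, $\mathbb{R}^n\setminus\mathrm{Hess}^+(f)$ and $\mathbb{R}^n\setminus\mathrm{Hess}^+(g)$ are additionally bounded, then $\mathbb{R}^n\setminus\mathrm{Hess}^+(fg)$ is bounded as well.
   Context: For a $C^2$-smooth function $f:\mathbb{R}^n\to\mathbb{R}$, $H_x(f)$ denotes the Hessian matrix of $f$ at $x$, and $\mathrm{Hess}^+(f)=\{x\in\mathbb{R}^n : H_x(f)\text{ is positive definite}\}$. The limit $p\to\infty$ means $\|p\|\to\infty$. ''Almost everywhere'' is with respect to Lebesgue measure on $\mathbb{R}^n$. For $f,g:\mathbb{R}^n\to\mathbb{R}$, the map $f\oplus g:\mathbb{R}^n\to\mathbb{R}^2$ is $(f\oplus g)(x)=(f(x),g(x))$. For a differentiable map $F:\mathbb{R}^n\to\mathbb{R}^m$, a point $x$ is a critical point of $F$ if $\mathrm{rank}(dF)_x<\min\{m,n\}$ and a regular point otherwise; $R(F)$ is the set of regular points of $F$. The function $fg$ is the pointwise product. *)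

(* Defs.v *)
From mathcomp Require Import all_boot all_order all_algebra.
From mathcomp Require Import all_classical all_reals all_analysis.

Set Implicit Arguments.
Unset Strict Implicit.
Unset Printing Implicit Defensive.

Import Order.TTheory GRing.Theory Num.Theory.
Import numFieldNormedType.Exports.

Local Open Scope classical_set_scope.
Local Open Scope ring_scope.

(* Points of R^n are row vectors. The library norm `|x| on 'rV[R]_n is the sup
   norm, hence the explicit Euclidean norm below. *)

Definition dotp (R : realType) (n : nat) (u v : 'rV[R]_n) : R :=
  (u *m v^T) 0 0.

Definition enorm (R : realType) (n : nat) (u : 'rV[R]_n) : R :=
  Num.sqrt (dotp u u).

(* The filter "p --> infinity", i.e. the Euclidean norm of p tends to +oo. *)
Definition infty_nbhs (R : realType) (n : nat) : set_system 'rV[R]_n :=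
  [set A | \forall M \near +oo, [set p | M < enorm p] `<=` A].
Arguments infty_nbhs {R} n.

#[global] Instance infty_nbhs_filter (R : realType) (n : nat) :
  Filter (@infty_nbhs R n).
Proof.
split=> [|A B|A B AB]; rewrite /infty_nbhs /=.
- exact: nearW.
- by apply: filterS2 => M sA sB p Mp; split; [exact: sA|exact: sB].
- by apply: filterS => M sA p Mp; exact/AB/sA.
Qed.

Definition partial (R : realType) (n : nat) (i : 'I_n) (f : 'rV[R]_n -> R) :
    'rV[R]_n -> R :=
  fun x => 'D_(delta_mx 0 i) f x.

(* f is C^(k+1) iff it is (Frechet) differentiable and its derivative, i.e.
   each of the components of the latter in the canonical basis, is C^k. *)
Fixpoint Csmooth (R : realType) (n k : nat) (f : 'rV[R]_n -> R) : Prop :=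
  match k with
  | 0 => continuous f
  | k'.+1 => (forall x, differentiable f x) /\
             (forall i, Csmooth k' (partial i f))
  end.

Definition grad (R : realType) (n : nat) (f : 'rV[R]_n -> R) (x : 'rV[R]_n) :
    'rV[R]_n :=
  \row_i partial i f x.

Definition hessian (R : realType) (n : nat) (f : 'rV[R]_n -> R)
    (x : 'rV[R]_n) : 'M[R]_n :=
  \matrix_(i, j) partial i (partial j f) x.

Definition posdef (R : realType) (n : nat) (A : 'M[R]_n) : Prop :=
  A^T = A /\ forall v : 'rV[R]_n, v != 0 -> 0 < (v *m A *m v^T) 0 0.

Definition Hess_pos (R : realType) (n : nat) (f : 'rV[R]_n -> R) :
    set 'rV[R]_n :=
  [set x | posdef (hessian f x)].

(* The following two are only meant for differentiable F: 'J F x represents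
   the differential of F at x (acting on row vectors on the right). *)
Definition critical_points (R : realType) (n m : nat)
    (F : 'rV[R]_n -> 'rV[R]_m) : set 'rV[R]_n :=
  [set x | (\rank ('J F x) < minn m n)%N].

Definition regular_points (R : realType) (n m : nat)
    (F : 'rV[R]_n -> 'rV[R]_m) : set 'rV[R]_n :=
  ~` critical_points F.

Definition oplus (R : realType) (n : nat) (f g : 'rV[R]_n -> R) :
    'rV[R]_n -> 'rV[R]_2 :=
  fun x => \row_(j < 2) [:: f x; g x]`_j.

Definition box (R : realType) (n : nat) (a b : 'rV[R]_n) : set 'rV[R]_n :=
  [set x | forall i, x 0 i \in `[a 0 i, b 0 i]].

Definition box_volume (R : realType) (n : nat) (a b : 'rV[R]_n) : \bar R :=
  (\prod_(i < n) lebesgue_measure (`[a 0%R i, b 0%R i] : set R))%E.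

(* n-dimensional Lebesgue outer measure: infimum of the total volume of
   countable covers by boxes. The index set D makes finite (and empty) covers
   available also when n = 0, where no box is empty. *)
Definition lebesgue_outer (R : realType) (n : nat) (A : set 'rV[R]_n) :
    \bar R :=
  ereal_inf [set s | exists (D : set nat) (a b : nat -> 'rV[R]_n),
    A `<=` \bigcup_(k in D) box (a k) (b k) /\
    s = (\esum_(k in D) box_volume (a k) (b k))%E].

(* A set is Lebesgue null iff its Lebesgue outer measure is zero. *)
Definition lebesgue_ae (R : realType) (n : nat) (P : 'rV[R]_n -> Prop) :
    Prop :=
  lebesgue_outer (~` [set x | P x]) = 0%E.

(* Main.v *)
(** Outside a bounded set [f] and [g] are positive with positive definite
    Hessians. For large [x], convexity of [f] along the ray from a fixed sphere
    to [x], together with [f x] exceeding the maximum of [f] on that sphere,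
    forces [<x, grad f x> > 0], and likewise for [g]. Since [x] is critical
    for [f (+) g], the two gradients are linearly dependent, and pairing them
    with [x] shows that they are positive multiples of each other. Hence
    [<v, grad f x> <v, grad g x> >= 0] for all [v], and
    [Hess (f g) = f Hess g + g Hess f + grad f^T grad g + grad g^T grad f] is
    positive definite. *)

Require Import Defs.
From mathcomp Require Import all_boot all_order all_algebra.
From mathcomp Require Import all_classical all_reals all_analysis.
From mathcomp Require Import ring.
Import Order.TTheory GRing.Theory Num.Theory.
Import numFieldNormedType.Exports.
Local Open Scope classical_set_scope.
Local Open Scope ring_scope.

Lemma dotpE {R : realType} {n} (u v : 'rV[R]_n) :
  dotp u v = \sum_i u 0 i * v 0 i.
Proof. by rewrite /dotp mxE; apply: eq_bigr => i _; rewrite mxE. Qed.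

Lemma le_norm_enorm {R : realType} {n} (u : 'rV[R]_n) : `|u| <= enorm u.
Proof.
rewrite [X in X <= _]/Num.norm /= mx_normrE.
apply/bigmax_leP; split=> [|[i j] _ /=]; first exact: sqrtr_ge0.
rewrite -sqrtr_sqr ler_wsqrtr// dotpE (bigD1 j)//= ord1 expr2 lerDl.
by apply: sumr_ge0 => k _; rewrite -expr2 sqr_ge0.
Qed.

Lemma diff_dotp_grad {R : realType} {n} (f : 'rV[R]_n -> R) x v :
  differentiable f x -> 'd f x v = dotp v (grad f x).
Proof.
move=> fx; rewrite [in LHS](row_sum_delta v) linear_sum dotpE.
by apply: eq_bigr => i _; rewrite linearZ mxE /partial deriveE.
Qed.

Lemma is_derive_ray {R : realType} {n} (f : 'rV[R]_n -> R) x (t : R) :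
  differentiable f (t *: x) ->
  is_derive t 1 (fun s => f (s *: x)) (dotp x (grad f (t *: x))).
Proof.
move=> fx.
have hx : differentiable (fun s : R => s *: x) t by exact: differentiableZl.
have fhx : differentiable (f \o (fun s : R => s *: x)) t.
  exact: differentiable_comp.
split; first exact/derivable1_diffP.
rewrite deriveE// diff_comp//= diff_dotp_grad//.
by rewrite diff_val /= scale1r.
Qed.

(** Column [i] of the Hessian is the gradient of [partial i f]. Grouped by columns, the quadratic
    form takes the shape that differentiating [dotp x (grad f (s *: x))] in [s] produces. *)
Lemma quad_hessianE {R : realType} {n} (f : 'rV[R]_n -> R) x v :
  (v *m hessian f x *m v^T) 0 0 =
  \sum_i v 0 i * dotp v (grad (partial i f) x).
Proof.
rewrite mxE; apply: eq_bigr => i _; rewrite mxE [v^T _ _]mxE mulrC dotpE.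
by congr (_ * _); apply: eq_bigr => j _; rewrite !mxE.
Qed.

Lemma is_derive2_ray {R : realType} {n} (f : 'rV[R]_n -> R) x (t : R) :
  (forall i, differentiable (partial i f) (t *: x)) ->
  is_derive t 1 (fun s => dotp x (grad f (s *: x)))
    ((x *m hessian f (t *: x) *m x^T) 0 0).
Proof.
move=> df; rewrite quad_hessianE.
have -> : (fun s => dotp x (grad f (s *: x))) =
    \sum_i (x 0 i \*: (fun s : R => partial i f (s *: x))).
  apply/funext => s; rewrite fct_sumE dotpE.
  by apply: eq_bigr => i _; rewrite mxE.
pose h i := x 0 i \*: (fun s : R => partial i f (s *: x)).
have H i : is_derive t 1 (h i) (x 0 i *: dotp x (grad (partial i f) (t *: x))).
  by apply: is_deriveZ; exact: is_derive_ray.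
exact: (is_derive_sum H).
Qed.

(** Passes from the Euclidean norm of [infty_nbhs] to the sup norm of [bounded_set]: the latter norm
    is the smaller one, so the same thresholds work. *)
Lemma near_infty_nbhs {R : realType} {n} (P : set 'rV[R]_n) :
  infty_nbhs n P -> \forall M \near +oo, forall x, M < `|x| -> P x.
Proof.
rewrite /infty_nbhs /=; apply: filterS => M PM x Mx; apply: PM.
exact: lt_le_trans Mx (le_norm_enorm x).
Qed.

Lemma bounded_setC_near {R : realType} {n} (A : set 'rV[R]_n) :
  bounded_set (~` A) <-> \forall M \near +oo, forall x, M < `|x| -> A x.
Proof.
rewrite /= /bounded_near /=; split; apply: filterS => M AM x.
  move=> Mx; apply: contrapT => /AM /=; by rewrite leNgt Mx.
by move=> /= nAx; rewrite leNgt; apply/negP => /AM.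
Qed.

Lemma bounded_above_closed_ball {R : realType} {n} (f : 'rV[R]_n -> R) (r : R) :
  continuous f -> exists B, forall x, `|x| <= r -> f x <= B.
Proof.
move=> cf; pose K := [set x : 'rV[R]_n | `|x| <= r].
have cK : compact K.
  apply: bounded_closed_compact.
    exists r; split=> [|M rM x /= xr]; first exact: num_real.
    exact/(le_trans xr)/ltW.
  apply: (preimage_closed (f := fun x : 'rV[R]_n => `|x|) (D := [set y | y <= r])).
    by move=> x _; exact: norm_continuous.
  exact: closed_le.
have [|M [_ HM]] := @compact_bounded _ _ (f @` K).
  by apply: continuous_compact => //; exact: continuous_subspaceT.
(* [HM] bounds the image only by numbers strictly above [M]. *)
exists (M + 1) => x xr; apply: le_trans (ler_norm _) _.
by apply: HM; [rewrite ltrDl|exists x].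
Qed.

Lemma near_radial_deriv_gt0 {R : realType} {n} (f : 'rV[R]_n -> R) :
  (forall x, differentiable f x) ->
  (forall i x, differentiable (partial i f) x) ->
  f p @[p --> infty_nbhs n] --> +oo ->
  bounded_set (~` Hess_pos f) ->
  \forall M \near +oo, forall x, M < `|x| -> 0 < dotp x (grad f x).
Proof.
move=> df ddf finfty /bounded_setC_near/pinfty_ex_gt0[r r0 Hr].
have [|B HB] := bounded_above_closed_ball f r.
  by move=> x; exact: differentiable_continuous.
have Bf : infty_nbhs n [set p | B < f p] by move/cvgryPgt : finfty; exact.
apply: filterS2 (nbhs_pinfty_gt (num_real r)) (near_infty_nbhs _ Bf) => M rM HM x Mx.
have rx : r < `|x| by exact: lt_trans Mx.
have x0 : 0 < `|x| by exact: lt_trans rx.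
have t01 : r / `|x| < 1 by rewrite ltr_pdivrMr// mul1r.
have df_ray (t : R) := is_derive_ray f x t (df _).
have d2f_ray (t : R) := is_derive2_ray f x t (fun i => ddf i _).
(* The ray through [x] meets the sphere of radius [r] at parameter [r / |x|]. The mean value theorem
   from there to [1] gives a positive slope at some [c], because [f] is at most [B] on the sphere
   and exceeds [B] at [x]. *)
have [|c /[!in_itv]/= /andP[tc c1] fc] := MVT t01 (fun t _ => df_ray t).
  by apply: derivable_within_continuous => t _; have [] := df_ray t.
have fc0 : 0 < dotp x (grad f (c *: x)).
  have d0 : 0 < 1 - r / `|x| by rewrite subr_gt0.
  rewrite -(pmulr_lgt0 _ d0) -fc subr_gt0 scale1r.
  apply: le_lt_trans (HM _ Mx); apply: HB.
  by rewrite normrZ ger0_norm ?divr_ge0 ?(ltW r0)// divfK// gt_eqF.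
(* A second mean value theorem, for the slope itself on [[c, 1]]: its increment is a positive
   multiple of the Hessian form at [d *: x]. This point lies outside the ball of radius [r], so the
   slope at [1] exceeds the one at [c]. *)
have [|d /[!in_itv]/= /andP[cd d1] fd] := MVT c1 (fun t _ => d2f_ray t).
  by apply: derivable_within_continuous => t _; have [] := d2f_ray t.
apply: (lt_trans fc0); rewrite -subr_gt0 -{2}[x]scale1r fd.
have td : r / `|x| < d by exact: lt_trans cd.
have d0 : 0 < d by apply: lt_trans td; rewrite divr_gt0.
have [|_ H] := Hr (d *: x); first by rewrite normrZ gtr0_norm// -ltr_pdivrMr.
by rewrite mulr_gt0 ?subr_gt0//; apply: H; rewrite -normr_gt0.
Qed.

Lemma partialM {R : realType} {n} (f g : 'rV[R]_n -> R) i :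
  (forall x, differentiable f x) -> (forall x, differentiable g x) ->
  partial i (fun x => f x * g x) =
  (fun x => f x * partial i g x + g x * partial i f x).
Proof.
move=> df dg; apply/funext => x.
by rewrite /partial (deriveM (diff_derivable (df x)) (diff_derivable (dg x))).
Qed.

Lemma gradE {R : realType} {n} (f : 'rV[R]_n -> R) x i :
  grad f x 0 i = partial i f x.
Proof. by rewrite mxE. Qed.

Lemma hessianE {R : realType} {n} (f : 'rV[R]_n -> R) x i j :
  hessian f x i j = partial i (partial j f) x.
Proof. by rewrite mxE. Qed.

Lemma mul_trmx_rowE {R : realType} {n} (u v : 'rV[R]_n) i j :
  (u^T *m v) i j = u 0 i * v 0 j.
Proof. by rewrite mxE big_ord1 mxE. Qed.

Lemma hessianM {R : realType} {n} (f g : 'rV[R]_n -> R) x :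
  (forall x, differentiable f x) -> (forall x, differentiable g x) ->
  (forall i x, differentiable (partial i f) x) ->
  (forall i x, differentiable (partial i g) x) ->
  hessian (fun x => f x * g x) x = f x *: hessian g x + g x *: hessian f x +
    ((grad f x)^T *m grad g x + (grad g x)^T *m grad f x).
Proof.
move=> df dg ddf ddg; apply/matrixP => i j.
have H : partial i (partial j (fun x => f x * g x)) x =
    f x * partial i (partial j g) x + partial j g x * partial i f x +
    (g x * partial i (partial j f) x + partial j f x * partial i g x).
  rewrite (partialM f g j)// {1}/partial.
  rewrite (deriveD (diff_derivable (differentiableM (df x) (ddg j x)))
                   (diff_derivable (differentiableM (dg x) (ddf j x)))).
  congr (_ + _).
    exact: (congr1 (@^~ x) (partialM f (partial j g) i df (ddg j))).
  exact: (congr1 (@^~ x) (partialM g (partial j f) i dg (ddf j))).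
(* Stated for arbitrary matrices so that [mxE] does not expand the Hessians and gradients. *)
have sumE (a b : R) (A B C D : 'M[R]_n) :
    (a *: A + b *: B + (C + D)) i j = a * A i j + b * B i j + (C i j + D i j).
  by rewrite !mxE.
rewrite sumE !mul_trmx_rowE !gradE [LHS]hessianE H addrACA.
congr (_ * _ + _ * _ + (_ + _)); [exact/esym/hessianE|exact/esym/hessianE|exact: mulrC|exact: mulrC].
Qed.

Lemma mul_jacobian_oplus {R : realType} {n} (f g : 'rV[R]_n -> R) x v :
  differentiable f x -> differentiable g x ->
  v *m 'J (oplus f g) x = \row_j [:: dotp v (grad f x); dotp v (grad g x)]`_j.
Proof.
move=> df dg.
(* Splitting along the basis of the plane reduces the differential to those of [f] and [g]. *)
have -> : oplus f g = (fun z => f z *: delta_mx 0 0 : 'rV[R]_2) +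
                      (fun z => g z *: delta_mx 0 1 : 'rV[R]_2).
  apply/funext => z; apply/rowP => -[[|[|//]] k]; rewrite !mxE/=;
    by rewrite ?mulr1 ?mulr0 ?addr0 ?add0r.
rewrite /jacobian mul_rV_lin1 /=.
have dZ (k : 'rV[R]_n -> R) (e : 'rV[R]_2) : differentiable k x ->
    'd (fun z => k z *: e) x v = dotp v (grad k x) *: e.
  by move=> dk; rewrite diffZl// diff_dotp_grad.
have := diffD (differentiableZl (delta_mx 0 0 : 'rV[R]_2) df)
              (differentiableZl (delta_mx 0 1 : 'rV[R]_2) dg).
move=> /(congr1 (@^~ v)) -> /=.
transitivity (dotp v (grad f x) *: delta_mx 0 0 +
              dotp v (grad g x) *: delta_mx 0 1 : 'rV[R]_2).
  congr (_ + _); [exact: dZ df|exact: dZ dg].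
move: (dotp v (grad f x)) (dotp v (grad g x)) => a b.
by apply/rowP => -[[|[|//]] k]; rewrite !mxE/= ?mulr1 ?mulr0 ?addr0 ?add0r.
Qed.

Lemma det_col_mx2 {R : comNzRingType} (a b c d : R) :
  \det (col_mx (\row_(j < 2) [:: a; b]`_j) (\row_(j < 2) [:: c; d]`_j)
    : 'M[R]_2) = a * d - c * b.
Proof.
have -> : col_mx (\row_(j < 2) [:: a; b]`_j) (\row_(j < 2) [:: c; d]`_j) =
    \matrix_(i < 2, j < 2) [:: [:: a; b]`_j; [:: c; d]`_j]`_i.
  by apply/matrixP => i j; rewrite !mxE; case: split_ordP => k ->;
    rewrite !mxE (ord1 k).
rewrite (expand_det_row _ 0) !big_ord_recl big_ord0 /cofactor !det_mx11 !mxE /=.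
ring.
Qed.

(** The difference of the two sides is the determinant of the Jacobian multiplied on the left by the
    rows [u] and [v]. Were it nonzero, the Jacobian would have rank at least 2, hence at least
    [minn 2 n], and [x] would be regular. *)
Lemma critical_oplus_dotp {R : realType} {n} (f g : 'rV[R]_n -> R) x u v :
  differentiable f x -> differentiable g x -> critical_points (oplus f g) x ->
  dotp u (grad f x) * dotp v (grad g x) = dotp v (grad f x) * dotp u (grad g x).
Proof.
move=> df dg; rewrite /critical_points /= => rk.
pose A := col_mx u v *m 'J (oplus f g) x.
have : \det A = 0.
  apply/eqP; apply: contraTT rk => detA; rewrite -leqNgt.
  apply: leq_trans (geq_minl _ _) _.
  apply: leq_trans (mxrankM_maxr (col_mx u v) _).
  by rewrite [\rank _]mxrank_unit// unitmxE unitfE.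
rewrite /A mul_col_mx (mul_jacobian_oplus _ _ _ u df dg).
rewrite (mul_jacobian_oplus _ _ _ v df dg) det_col_mx2.
by move/eqP; rewrite subr_eq0 => /eqP.
Qed.

(** The two dyads are transposes of each other, so their sum is symmetric, and its quadratic form at
    [v] is twice [dotp v p * dotp v q]. *)
Lemma posdef_rank2_perturb {R : realType} {n} (A B : 'M[R]_n)
    (p q : 'rV[R]_n) a b :
  posdef A -> posdef B -> 0 < a -> 0 < b ->
  (forall v, 0 <= dotp v p * dotp v q) ->
  posdef (a *: A + b *: B + (p^T *m q + q^T *m p)).
Proof.
move=> [symA posA] [symB posB] a0 b0 pq0; split=> [|v v0].
  rewrite !linearD !linearZ /= symA symB !trmx_mul !trmxK.
  by congr (_ + _); rewrite addrC.
have dyad (r s : 'rV[R]_n) : (v *m (r^T *m s) *m v^T) 0 0 = dotp v r * dotp v s.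
  rewrite mulmxA -mulmxA [LHS]mxE big_ord1; congr (_ * _).
  by rewrite -[s]trmxK -trmx_mul trmxK mxE.
rewrite !mulmxDr !mulmxDl -!scalemxAr -!scalemxAl.
have addE (X Y : 'M[R]_1) : (X + Y) 0 0 = X 0 0 + Y 0 0 by rewrite mxE.
have scaleE c (X : 'M[R]_1) : (c *: X) 0 0 = c * X 0 0 by rewrite mxE.
rewrite !addE !scaleE !dyad.
rewrite ltr_pwDl ?addr_gt0 ?mulr_gt0 ?posA ?posB//.
by rewrite addr_ge0// mulrC.
Qed.

Theorem theorem3p3 (R : realType) (n : nat) (f g : 'rV[R]_n -> R)
  (f_C2 : Csmooth 2 f) (g_C2 : Csmooth 2 g)
  (f_infty : f p @[p --> infty_nbhs n] --> +oo)
  (g_infty : g p @[p --> infty_nbhs n] --> +oo)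
  (grad_fg : lebesgue_ae (fun x =>
     0 < dotp (grad f x) (grad g x) + enorm (grad f x) * enorm (grad g x)))
  (reg_bounded : bounded_set (regular_points (oplus f g)))
  (hess_f_bounded : bounded_set (~` Hess_pos f))
  (hess_g_bounded : bounded_set (~` Hess_pos g)) :
  bounded_set (~` Hess_pos (fun x => f x * g x)).
Proof.
have [df C1f] := f_C2; have [dg C1g] := g_C2.
have ddf i : forall x, differentiable (partial i f) x by have [] := C1f i.
have ddg i : forall x, differentiable (partial i g) x by have [] := C1g i.
have f0 : infty_nbhs n [set p | 0 < f p] by move/cvgryPgt : f_infty; exact.
have g0 : infty_nbhs n [set p | 0 < g p] by move/cvgryPgt : g_infty; exact.
have {}f0 := near_infty_nbhs _ f0; have {}g0 := near_infty_nbhs _ g0.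
have xf := near_radial_deriv_gt0 f df ddf f_infty hess_f_bounded.
have xg := near_radial_deriv_gt0 g dg ddg g_infty hess_g_bounded.
move/bounded_setC_near in reg_bounded.
move/bounded_setC_near in hess_f_bounded.
move/bounded_setC_near in hess_g_bounded.
(* [M] is taken beyond the thresholds of all seven facts used below. *)
apply/bounded_setC_near; near=> M => x Mx.
have fx : 0 < f x by exact: (near f0 M).
have gx : 0 < g x by exact: (near g0 M).
have xfx : 0 < dotp x (grad f x) by exact: (near xf M).
have xgx : 0 < dotp x (grad g x) by exact: (near xg M).
have crit : critical_points (oplus f g) x by exact: (near reg_bounded M).
have [symf posf] : Hess_pos f x by exact: (near hess_f_bounded M).
have [symg posg] : Hess_pos g x by exact: (near hess_g_bounded M).
rewrite /Hess_pos /= (hessianM f g x df dg ddf ddg).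
apply: posdef_rank2_perturb => // v.
have fgE := critical_oplus_dotp f g x x v (df x) (dg x) crit.
(* Multiplying by the positive [dotp x (grad f x)] and using [fgE] turns the product into the square
   of [dotp v (grad f x)] times [dotp x (grad g x)]; the factor relating the gradients is never
   formed. *)
rewrite -(pmulr_rge0 _ xfx) mulrCA fgE mulrA -expr2.
by rewrite mulr_ge0 ?sqr_ge0// ltW.
Unshelve. all: by end_near. Qed.
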